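(* If $D=(X,Y,A)$ is a complete oriented split graph, then $D$ has a Sullivan vertex, i.e. a vertex $u$ with $|N^{++}(u)|\ge |N^-(u)|$.
   Context: An oriented split graph $D=(X,Y,A)$ is an oriented graph (loopless, no pair of opposite arcs) whose vertex set is partitioned into $X$ and $Y$ with $X$ independent and $D[Y]$ a tournament. It is complete if for every $x\in X$ and $y\in Y$ exactly one of the arcs $xy$, $yx$ is present. $N^-(u)=\{v:vu\in A\}$, $N^+(u)=\{v:uv\in A\}$, $N^{++}(u)=\{v: uw,wv\in A\text{ for some } w\}\setminus N^+(u)$. *)

(* Defs.v *)
From mathcomp Require Import all_boot.

Set Implicit Arguments.
Unset Strict Implicit.
Unset Printing Implicit Defensive.

(* A finite digraph is given by its arc relation A on the finType V of its
   vertices: A u v means that uv is an arc. *)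
Section Digraph.

Variables (V : finType) (A : rel V).

Definition oriented_graph : Prop :=
  irreflexive A /\ (forall u v, ~~ (A u v && A v u)).

Definition independent (X : {set V}) : Prop :=
  {in X &, forall u v, ~~ A u v}.

Definition induces_tournament (Y : {set V}) : Prop :=
  {in Y &, forall u v, u != v -> A u v (+) A v u}.

(* The parts may be empty, so finset's [partition], which requires nonempty
   blocks, is not used. *)
Definition oriented_split_graph (X Y : {set V}) : Prop :=
  [/\ oriented_graph,
      X :|: Y = [set: V],
      [disjoint X & Y],
      independent X
    & induces_tournament Y].

Definition complete_oriented_split_graph (X Y : {set V}) : Prop :=
  oriented_split_graph X Y /\
  (forall x y, x \in X -> y \in Y -> A x y (+) A y x).

Definition in_nbh (u : V) : {set V} := [set v | A v u].

Definition out_nbh (u : V) : {set V} := [set v | A u v].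

Definition second_out_nbh (u : V) : {set V} :=
  [set v | [exists w, A u w && A w v]] :\: out_nbh u.

Definition sullivan_vertex (u : V) : Prop :=
  #|in_nbh u| <= #|second_out_nbh u|.

End Digraph.

(* Main.v *)
Require Import Defs.
From mathcomp Require Import all_boot.

(** Let [y] be a king of the tournament on [Y]. If [y] reaches every
    in-neighbour in two steps, [y] is a Sullivan vertex. Otherwise some [x] in
    [X] dominates [y] and all out-neighbours of [y] in [Y]; every in-neighbour
    of [x] is then an in-neighbour of [y] in [Y], hence reached from [y], and
    so also from [x], through an out-neighbour of [y] in [Y]. *)

(** A vertex [y] of maximum out-degree inside [Y] works: if [z] beats [y] and no two-step path leads
    back, then [z] beats [y] and all that [y] beats in [Y], so its out-degree is larger. *)
Lemma tournament_king (V : finType) (A : rel V) (Y : {set V}) :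
    oriented_graph A -> induces_tournament A Y -> Y != set0 ->
  exists2 y, y \in Y &
    {in Y, forall z, A z y -> exists2 w, w \in Y & A y w && A w z}.
Proof.
move=> [irrA asymA] tourY /set0Pn[y0 y0Y].
pose d v := #|[set w in Y | A v w]|.
case: (arg_maxnP d y0Y) => y yY max_y; exists y => // z zY zy.
have [/exists_inP //|/exists_inPn noW] :=
  boolP [exists w in Y, A y w && A w z].
suff /proper_card : [set w in Y | A y w] \proper [set w in Y | A z w].
  by rewrite ltnNge => /negP[]; apply: max_y.
apply/properP; split.
  apply/subsetP=> w; rewrite !inE => /andP[wY yw]; rewrite wY /=.
  have nwz : ~~ A w z by have := noW w wY; rewrite yw.
  have wz : w != z by apply/eqP=> wz; have := asymA z y; rewrite zy -wz yw.
  by have := tourY w z wY zY wz; rewrite (negbTE nwz).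
by exists y; rewrite !inE ?zy ?irrA ?andbT ?andbF.
Qed.

(** By asymmetry no in-neighbour of [u] is an out-neighbour, so all of them lie in
    [second_out_nbh A u]. *)
Lemma sullivan_vertex_two_steps (V : finType) (A : rel V) (u : V) :
    oriented_graph A ->
    (forall v, A v u -> exists2 w, A u w & A w v) ->
  sullivan_vertex A u.
Proof.
move=> [_ asymA] reach; apply: subset_leq_card; apply/subsetP=> v.
rewrite !inE => vu; have [w uw wv] := reach v vu.
have := asymA v u; rewrite vu /= => -> /=.
by apply/existsP; exists w; rewrite uw.
Qed.

Theorem theorem4p4 (V : finType) (A : rel V) (X Y : {set V})
    (hV : 0 < #|V|) (hD : complete_oriented_split_graph A X Y) :
  exists u : V, sullivan_vertex A u.
Proof.
case: hD => -[orA coverXY _ indX tourY] complXY; have [_ asymA] := orA.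
have inXY v : (v \in X) || (v \in Y) by rewrite -in_setU coverXY inE.
have [Y0|Y_n0] := eqVneq Y set0.
  (* With [Y] empty there are no arcs, so any vertex works vacuously. *)
  have /card_gt0P[u _] := hV; exists u.
  apply: sullivan_vertex_two_steps => // v vu.
  have inX t : t \in X by have := inXY t; rewrite Y0 in_set0 orbF.
  by have := indX v u (inX v) (inX u); rewrite vu.
have [y yY king_y] := tournament_king V A Y orA tourY Y_n0.
have [/exists_inP[x xX /andP[xy /forall_inP dom_x]]|no_x] :=
  boolP [exists x in X, A x y && [forall w in Y, A y w ==> A x w]].
  exists x; apply: sullivan_vertex_two_steps => // z zx.
  have zY : z \in Y.
    case/orP: (inXY z) => // zX.
    by have := indX z x zX xX; rewrite zx.
  have zneqy : z != y.
    by apply/eqP=> zy; have := asymA z x; rewrite zx zy xy.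
  have nyz : ~~ A y z.
    apply/negP=> yz; have := asymA z x.
    by rewrite zx (implyP (dom_x z zY) yz).
  have zy : A z y.
    by have := tourY z y zY yY zneqy; rewrite (negbTE nyz) addbF.
  have [w wY /andP[yw wz]] := king_y z zY zy.
  by exists w => //; apply: (implyP (dom_x w wY)).
exists y; apply: sullivan_vertex_two_steps => // z zy.
case/orP: (inXY z) => [zX|zY]; last first.
  by have [w _ /andP[]] := king_y z zY zy; exists w.
(* Some out-neighbour [w] of [y] in [Y] is not dominated by [z]; completeness then gives the arc
   from [w] to [z]. *)
have /exists_inPn/(_ z zX) := no_x; rewrite zy /= => /forall_inPn[w wY].
rewrite negb_imply => /andP[yw nzw]; exists w => //.
by have := complXY z w zX wY; rewrite (negbTE nzw).
Qed.
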